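(* Let $\mathcal M$ be a unichain, indexable MDP whose Whittle indices $(\lambda_s)_{s\in\mathcal S}$ are pairwise distinct. Then there exists $\delta>0$ such that every MDP $\widehat{\mathcal M}=(\mathcal S,\{0,1\},(\hat P^a)_a,(r^a)_a)$ which has the same rewards as $\mathcal M$, has the same support as $\mathcal M$, and satisfies $\|\mathcal M-\widehat{\mathcal M}\|_\infty\le\delta$, is indexable. In other words, $\mathcal M$ is an interior point (within MDPs with the same support and rewards) of the set of indexable MDPs.
   Context: Setting. An MDP is $\mathcal M=(\mathcal S,\{0,1\},(P^a)_{a\in\{0,1\}},(r^a)_{a\in\{0,1\}})$, with finite state space $\mathcal S$, row-stochastic matrices $P^0,P^1\in\mathbb R^{\mathcal S\times\mathcal S}$, and reward vectors $r^0,r^1\in\mathbb R^{\mathcal S}$. A policy is identified with the subset $\pi\subseteq\mathcal S$ of states where action $1$ is played; it induces $P^\pi$ (row $s$ equal to $P^1_{s,\cdot}$ if $s\in\pi$ and $P^0_{s,\cdot}$ otherwise) and $r^\pi$ similarly. $\mathcal M$ is unichain if $P^\pi$ has a single recurrent class for every policy $\pi$. For $\lambda\in\mathbb R$, the penalized MDP $\mathcal M(\lambda)$ has the same transitions and rewards $r^1-\lambda\mathbf 1$ (action 1) and $r^0$ (action 0). For a unichain policy $\pi$ in $\mathcal M(\lambda)$, the gain $g^\pi(\lambda)\in\mathbb R$ and bias $b^\pi(\lambda)\in\mathbb R^{\mathcal S}$ (defined up to an additive constant) solve $g^\pi\mathbf 1+b^\pi=r^\pi+P^\pi b^\pi$.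 The activation advantage of $s$ under $\pi$ is $\alpha^\pi_s(\lambda)=r^1_s-\lambda-r^0_s+(P^1_{s,\cdot}-P^0_{s,\cdot})\cdot b^\pi(\lambda)$. A policy is BO (bias optimal) in $\mathcal M(\lambda)$ if it is gain optimal and has maximal bias among gain-optimal policies; for unichain MDPs, $\pi$ is BO in $\mathcal M(\lambda)$ iff $\alpha^\pi_s(\lambda)\ge 0$ for all $s\in\pi$ and $\alpha^\pi_s(\lambda)\le0$ for all $s\notin\pi$. The optimal activation advantage is $\alpha^*_s(\lambda):=\alpha^\pi_s(\lambda)$ for any BO policy $\pi$ of $\mathcal M(\lambda)$ (this does not depend on the choice). $\mathcal M$ is indexable if for every $s\in\mathcal S$ there is $\lambda_s\in\mathbb R$ (the Whittle index of $s$) with $\alpha^*_s(\lambda)>0$ for $\lambda<\lambda_s$ and $\alpha^*_s(\lambda)<0$ for $\lambda>\lambda_s$. Hats denote the same objects computed in $\widehat{\mathcal M}$. For matrices, $\|A\|_\infty=\max_s\sum_{s'}|A_{s,s'}|$; for two MDPs with the same rewards, $\|\mathcal M-\widehat{\mathcal M}\|_\infty:=\max_{a\in\{0,1\}}\|P^a-\hat P^a\|_\infty$. $\mathcal M$ and $\widehat{\mathcal M}$ have the same support if for all $a,s,s'$: $P^a_{s,s'}>0\iff\hat P^a_{s,s'}>0$. *)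

(* Defs.v *)
(* states form a finType S, actions are bool (true = action 1),
   reals are an arbitrary R : realType. *)
From HB Require Import structures.
From mathcomp Require Import all_boot all_order all_algebra.
From mathcomp Require Import reals.
Set Implicit Arguments. Unset Strict Implicit. Unset Printing Implicit Defensive.
Import Order.TTheory GRing.Theory Num.Theory.
Local Open Scope ring_scope.

Section MDPDefs.
Variables (R : realType) (S : finType).

Definition row_stochastic (P : bool -> S -> S -> R) : Prop :=
  forall a s, (forall s', 0 <= P a s s') /\ \sum_(s' : S) P a s s' = 1.

(* A policy is a subset pi of states (where action 1 = true is played). *)
Definition Ppol (P : bool -> S -> S -> R) (pi : {set S}) : S -> S -> R :=
  fun s s' => P (s \in pi) s s'.

Definition rpol (r : bool -> S -> R) (lam : R) (pi : {set S}) : S -> R :=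
  fun s => if s \in pi then r true s - lam else r false s.

Definition reach (Q : S -> S -> R) : rel S :=
  connect [rel s s' | 0 < Q s s'].

Definition recurrent (Q : S -> S -> R) (s : S) : Prop :=
  forall s', reach Q s s' -> reach Q s' s.

Definition single_recurrent_class (Q : S -> S -> R) : Prop :=
  (exists s, recurrent Q s) /\
  (forall s s', recurrent Q s -> recurrent Q s' -> reach Q s s').

Definition unichain (P : bool -> S -> S -> R) : Prop :=
  forall pi : {set S}, single_recurrent_class (Ppol P pi).

Definition stationary (Q : S -> S -> R) (mu : S -> R) : Prop :=
  (forall s, 0 <= mu s) /\ \sum_(s : S) mu s = 1 /\
  (forall s', \sum_(s : S) mu s * Q s s' = mu s').

(* g, b are the gain and the bias of pi in M(lam): they solve the Poisson
   equation g 1 + b = r^pi + P^pi b, and b is the (normalized) bias, i.e.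
   it has zero mean under the stationary distribution of P^pi. *)
Definition gain_bias (P : bool -> S -> S -> R) (r : bool -> S -> R) (lam : R)
    (pi : {set S}) (g : R) (b : S -> R) : Prop :=
  (forall s, g + b s = rpol r lam pi s + \sum_(s' : S) Ppol P pi s s' * b s') /\
  (exists mu, stationary (Ppol P pi) mu /\ \sum_(s : S) mu s * b s = 0).

Definition BO_with (P : bool -> S -> S -> R) (r : bool -> S -> R) (lam : R)
    (pi : {set S}) (g : R) (b : S -> R) : Prop :=
  gain_bias P r lam pi g b /\
  (forall pi' g' b', gain_bias P r lam pi' g' b' -> g' <= g) /\
  (forall pi' g' b', gain_bias P r lam pi' g' b' -> g' = g ->
     forall s, b' s <= b s).

Definition advantage (P : bool -> S -> S -> R) (r : bool -> S -> R) (lam : R)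
    (b : S -> R) (s : S) : R :=
  r true s - lam - r false s + \sum_(s' : S) (P true s s' - P false s s') * b s'.

Definition opt_advantage (P : bool -> S -> S -> R) (r : bool -> S -> R) (lam : R)
    (s : S) (a : R) : Prop :=
  exists pi g b, BO_with P r lam pi g b /\ a = advantage P r lam b s.

Definition whittle_index (P : bool -> S -> S -> R) (r : bool -> S -> R)
    (s : S) (ls : R) : Prop :=
  forall lam a, opt_advantage P r lam s a ->
    (lam < ls -> 0 < a) /\ (ls < lam -> a < 0).

Definition indexable (P : bool -> S -> S -> R) (r : bool -> S -> R) : Prop :=
  forall s, exists ls, whittle_index P r s ls.

Definition same_support (P Ph : bool -> S -> S -> R) : Prop :=
  forall a s s', 0 < P a s s' <-> 0 < Ph a s s'.

Definition dist_le (P Ph : bool -> S -> S -> R) (delta : R) : Prop :=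
  forall a s, \sum_(s' : S) `|P a s s' - Ph a s s'| <= delta.

End MDPDefs.

(* Main.v *)
Require Import Defs.
From HB Require Import structures.
From mathcomp Require Import boolp classical_sets filter topology normedtype.
From mathcomp Require Import all_boot all_order all_algebra.
From mathcomp Require Import reals.
From mathcomp Require Import ring lra.
Import Order.TTheory GRing.Theory Num.Theory.
Import numFieldNormedType.Exports.
Local Open Scope ring_scope.
Set Implicit Arguments.
Unset Strict Implicit.

(** For a fixed policy the advantages are affine functions of the penalty whose
    coefficients are, by Cramer's rule, continuous in the transition
    probabilities. In [M], at the penalty [lam s] the policy
    [{t | lam s <= lam t}] is optimal, the advantage of [s] vanishes with a
    negative slope, and by distinctness of the indices all other advantages
    are nonzero. These are finitely many strict inequalities, so for a small
    perturbation the advantage of [s] under the same policy still crosses zero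
    at some [lh s], the crossings are ordered like the indices, and the other
    advantages keep their signs there. Between two consecutive crossings the
    signs follow because affine functions have the right signs at both ends.
    Bias optimality is related to these signs by Howard's policy improvement
    and by uniqueness, up to a constant, of the solution of the Bellman
    equation of a unichain MDP. *)

(** * Finite Markov chains *)

Section Chain.
Variables (R : realType) (S : finType).
Implicit Types (Q : S -> S -> R) (A C D : {set S}) (d r mu : S -> R).

Definition stochastic Q := forall s, (forall s', 0 <= Q s s') /\ \sum_s' Q s s' = 1.

Definition mean Q d s := \sum_s' Q s s' * d s'.

Definition closed_set Q A := forall s s', s \in A -> 0 < Q s s' -> s' \in A.

Lemma closed_set_reach Q A s s' :
  closed_set Q A -> s \in A -> reach Q s s' -> s' \in A.
Proof.
move=> clA sA /connectP[p pth ->]; elim: p s sA pth => //= x p IH s sA /andP[sx].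
by apply: IH; apply: clA sx.
Qed.

(** Take a state of [A] whose reachable set has least cardinality. Any state reachable from it has a
    reachable set that is contained in this one, hence equal to it, and so leads back. *)
Lemma closed_set_recurrent Q A x :
  closed_set Q A -> x \in A -> exists2 y, y \in A & recurrent Q y.
Proof.
move=> clA xA; case: (arg_minnP (fun y => #|reach Q y|) xA) => y yA miny.
exists y => // z yz; have zA := closed_set_reach clA yA yz.
have sub : reach Q z \subset reach Q y.
  by apply/subsetP => w; rewrite !unfold_in; apply: connect_trans.
have [_] := subset_leqif_card sub; rewrite eqn_leq subset_leq_card // miny //.
by move=> /esym/subsetP/(_ y); apply; rewrite unfold_in; apply: connect0.
Qed.

(** This is the form in which the unichain hypothesis is used. Each closed set contains a recurrent
    state, and one of these two states reaches the other. *)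
Lemma closed_sets_meet Q A C x y :
    single_recurrent_class Q -> closed_set Q A -> closed_set Q C ->
    x \in A -> y \in C -> exists2 z, z \in A & z \in C.
Proof.
move=> [_ rec1] clA clC xA yC.
have [a aA arec] := closed_set_recurrent clA xA.
have [c cC crec] := closed_set_recurrent clC yC.
by exists c => //; apply: closed_set_reach clA aA (rec1 _ _ arec crec).
Qed.

Lemma meanB Q d d' s : mean Q (fun t => d t - d' t) s = mean Q d s - mean Q d' s.
Proof. by rewrite /mean -sumrB; apply: eq_bigr => t _; rewrite mulrBr. Qed.

Lemma meanN Q d s : mean Q (fun t => - d t) s = - mean Q d s.
Proof. by rewrite /mean -sumrN; apply: eq_bigr => t _; rewrite mulrN. Qed.

Lemma meanZ Q c d s : mean Q (fun t => c * d t) s = c * mean Q d s.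
Proof. by rewrite /mean mulr_sumr; apply: eq_bigr => t _; rewrite mulrCA. Qed.

Lemma mean_cst Q c s : stochastic Q -> mean Q (fun=> c) s = c.
Proof. by move=> /(_ s)[_ Q1]; rewrite /mean -mulr_suml Q1 mul1r. Qed.

Lemma eq_mean Q d d' s : (forall t, d t = d' t) -> mean Q d s = mean Q d' s.
Proof. by move=> dd'; apply: eq_bigr => t _; rewrite dd'. Qed.

Lemma mean_ge Q m d s : stochastic Q -> (forall t, m <= d t) -> m <= mean Q d s.
Proof.
move=> Qs md; rewrite -[m](@mean_cst Q _ s) //; apply: ler_sum => t _.
by apply: ler_wpM2l => //; case: (Qs s).
Qed.

Lemma mean_le Q m d s : stochastic Q -> (forall t, d t <= m) -> mean Q d s <= m.
Proof.
move=> Qs dm; rewrite -[leRHS](@mean_cst Q _ s) //; apply: ler_sum => t _.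
by apply: ler_wpM2l => //; case: (Qs s).
Qed.

(** At a state where [d] equals [m], the average of [d - m] over the successors is at most zero,
    while all its terms are nonnegative. So [d] equals [m] at every successor. *)
Lemma argmin_closed Q C m d :
    stochastic Q -> closed_set Q C -> (forall s, s \in C -> m <= d s) ->
    (forall s, s \in C -> d s = m -> mean Q d s <= m) ->
  closed_set Q [set s in C | d s == m].
Proof.
move=> Qs clC minC sup s s'; rewrite !inE => /andP[sC /eqP dsm] Qss'.
have s'C := clC _ _ sC Qss'; rewrite s'C /=.
have [Q0 Q1] := Qs s.
have term_ge0 t : 0 <= Q s t * (d t - m).
  case: (ltrgtP 0 (Q s t)) (Q0 t) => // [Qt _ | <-]; last by rewrite mul0r.
  by rewrite pmulr_rge0 // subr_ge0; apply/minC/(clC s).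
have : \sum_t Q s t * (d t - m) <= 0.
  by have := meanB Q d (fun=> m) s; rewrite mean_cst // /mean => ->;
     rewrite subr_le0; apply: sup.
move=> sum_le0; have : \sum_t Q s t * (d t - m) = 0.
  by apply/eqP; rewrite eq_le sum_le0 sumr_ge0.
move=> /eqP; rewrite psumr_eq0 => [/allP /(_ s' (mem_index_enum _)) /=|//].
by rewrite mulf_eq0 gt_eqF //= subr_eq0.
Qed.

Lemma argmax_closed Q C m d :
    stochastic Q -> closed_set Q C -> (forall s, s \in C -> d s <= m) ->
    (forall s, s \in C -> d s = m -> m <= mean Q d s) ->
  closed_set Q [set s in C | d s == m].
Proof.
move=> Qs clC maxC sub.
have -> : [set s in C | d s == m] = [set s in C | - d s == - m].
  by apply/setP => s; rewrite !inE eqr_opp.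
apply: argmin_closed => // s sC; first by rewrite lerN2; apply: maxC.
by move=> /oppr_inj dsm; rewrite meanN lerN2; apply: sub.
Qed.

(** The minimisers of [d] on [C] and its maximisers on [D] form closed sets, so they share a
    state. *)
Lemma superharmonic_subharmonic_meet Q C D d x0 y0 :
    stochastic Q -> single_recurrent_class Q ->
    closed_set Q C -> closed_set Q D -> x0 \in C -> y0 \in D ->
    (forall s, s \in C -> mean Q d s <= d s) ->
    (forall s, s \in D -> d s <= mean Q d s) ->
  exists x, (forall y, y \in C -> d x <= d y) /\ (forall y, y \in D -> d y <= d x).
Proof.
move=> Qs Q1 clC clD x0C y0D sup sub.
case: (arg_minP d x0C) => x xC minx; case: (arg_maxP d y0D) => y yD maxy.
have clA : closed_set Q [set s in C | d s == d x].
  by apply: argmin_closed => // s sC <-; apply: sup.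
have clB : closed_set Q [set s in D | d s == d y].
  by apply: argmax_closed => // s sD <-; apply: sub.
have [| |z] := closed_sets_meet (x := x) (y := y) Q1 clA clB.
- by rewrite inE eqxx andbT.
- by rewrite inE eqxx andbT.
rewrite !inE => /andP[zC /eqP zx] /andP[zD /eqP zy].
by exists z; split=> w; [rewrite zx; apply: minx | rewrite zy; apply: maxy].
Qed.

Lemma closed_setT Q : closed_set Q [set: S].
Proof. by move=> s s' _ _; rewrite inE. Qed.

Lemma harmonic_constant Q d :
  stochastic Q -> single_recurrent_class Q -> (forall s, d s = mean Q d s) ->
  forall s t, d s = d t.
Proof.
move=> Qs Q1 harm s t.
have [||x [xmin xmax]] := superharmonic_subharmonic_meet (d := d) (x0 := s)
  (y0 := s) Qs Q1 (@closed_setT Q) (@closed_setT Q) (in_setT _) (in_setT _).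
- by move=> u _; rewrite -harm.
- by move=> u _; rewrite -harm.
have dx u : d u = d x by apply/eqP; rewrite eq_le xmin ?xmax // inE.
by rewrite !dx.
Qed.

(** * The Poisson equation *)

Definition poisson Q r (h : R) d := forall s, h + d s = r s + mean Q d s.

(** Evaluate the equation at a minimiser of [d], where the mean of [d] is at least [d]. *)
Lemma poisson_gain_ge0 (s0 : S) Q r h d :
  stochastic Q -> poisson Q r h d -> (forall s, 0 <= r s) -> 0 <= h.
Proof.
move=> Qs pois r0; case: (arg_minP d (erefl (xpredT s0))) => x _ minx.
have := pois x; have := @mean_ge Q (d x) d x Qs (fun t => minx t erefl).
have := r0 x; lra.
Qed.

Lemma poissonZ c Q r h d :
  poisson Q r h d -> poisson Q (fun s => c * r s) (c * h) (fun s => c * d s).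
Proof. by move=> pois s; rewrite meanZ -!mulrDr pois. Qed.

Lemma poissonB Q r h d r' h' d' :
  poisson Q r h d -> poisson Q r' h' d' ->
  poisson Q (fun s => r s - r' s) (h - h') (fun s => d s - d' s).
Proof. move=> pois pois' s; rewrite meanB; have := pois s; have := pois' s; lra. Qed.

Lemma poisson_shift c Q r h d :
  stochastic Q -> poisson Q r h d -> poisson Q r h (fun s => d s - c).
Proof. move=> Qs pois s; rewrite meanB mean_cst //; have := pois s; lra. Qed.

Lemma eq_poisson Q r r' h d :
  (forall s, r s = r' s) -> poisson Q r h d -> poisson Q r' h d.
Proof. by move=> rr' pois s; rewrite -rr'. Qed.

Lemma poisson_unique (s0 : S) Q r h d h' d' :
  stochastic Q -> single_recurrent_class Q ->
  poisson Q r h d -> poisson Q r h' d' ->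
  h = h' /\ forall s t, d s - d' s = d t - d' t.
Proof.
move=> Qs Q1 pois pois'; have hh' : h = h'.
  apply/le_anti/andP; split; rewrite -subr_ge0.
    by apply: (poisson_gain_ge0 s0 Qs (poissonB pois' pois)) => s; rewrite subrr.
  by apply: (poisson_gain_ge0 s0 Qs (poissonB pois pois')) => s; rewrite subrr.
split=> //; apply: (@harmonic_constant Q (fun s => d s - d' s)) => // s.
by have := poissonB pois pois' s; rewrite hh' !subrr !add0r.
Qed.

(** The unknowns of the Poisson equation normalised by [d s0 = 0] are packed in
    one vector indexed by [S], whose entry at [s0] holds the gain. *)
Definition poisson_mx Q (s0 : S) : 'M[R]_#|S| :=
  \matrix_(i, j) (if enum_val j == s0 then 1
                  else (enum_val i == enum_val j)%:R - Q (enum_val i) (enum_val j)).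

(** Written as adjugate over determinant, so that continuity in [Q] reduces to that of sums,
    products and one quotient. *)
Definition poisson_sol Q s0 r (s : S) : R :=
  ((\det (poisson_mx Q s0))^-1 *: (\adj (poisson_mx Q s0) *m \col_i r (enum_val i)))
    (enum_rank s) 0.

(** Recovers the bias from a packed vector: the gain stored at [s0] is replaced by the normalised
    value [0]. *)
Definition pointed (s0 : S) (x : S -> R) (s : S) : R := if s == s0 then 0 else x s.

Lemma mul_poisson_mx Q s0 (x : 'cV[R]_#|S|) s :
  let f t := x (enum_rank t) 0 in
  (poisson_mx Q s0 *m x) (enum_rank s) 0 =
    f s0 + pointed s0 f s - mean Q (pointed s0 f) s.
Proof.
move=> f; rewrite mxE (reindex _ (onW_bij _ (@enum_rank_bij S))) /=.
under eq_bigr => t _ do rewrite mxE !enum_rankK -/(f t).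
rewrite /mean (bigD1 s0) //= eqxx mul1r -addrA; congr (_ + _).
rewrite [X in _ - X](bigD1 s0) //= {2}/pointed eqxx mulr0 add0r.
under eq_bigr => t ts0 do rewrite (negPf ts0) mulrBl.
rewrite sumrB; congr (_ - _); last first.
  by apply: eq_bigr => t ts0; rewrite /pointed (negPf ts0).
rewrite /pointed; case: eqVneq => [->|ss0].
  by rewrite big1 // => t ts0; rewrite eq_sym (negPf ts0) mul0r.
rewrite (bigD1 s) //= eqxx mul1r big1 ?addr0 // => t /andP[_ ts].
by rewrite eq_sym (negPf ts) mul0r.
Qed.

(** A kernel vector encodes a solution for the zero reward. By uniqueness its gain is zero and its
    bias is constant, hence zero because it vanishes at [s0]. *)
Lemma poisson_mx_unit Q s0 :
  stochastic Q -> single_recurrent_class Q -> poisson_mx Q s0 \in unitmx.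
Proof.
move=> Qs Q1; rewrite unitmxE unitfE -det_tr; apply/negP => /det0P[v v0 vL].
have Lv : poisson_mx Q s0 *m v^T = 0 by rewrite -[LHS]trmxK trmx_mul trmxK vL trmx0.
pose f t := v^T (enum_rank t) 0.
have pois : poisson Q (fun=> 0) (f s0) (pointed s0 f).
  move=> s; have := mul_poisson_mx Q s0 v^T s.
  by rewrite Lv mxE /= => /esym/eqP; rewrite subr_eq0 add0r => /eqP.
have pois0 : poisson Q (fun=> 0) 0 (fun=> 0).
  by move=> s; rewrite mean_cst.
have [fs0 fc] := poisson_unique s0 Qs Q1 pois pois0.
case/negP: v0; apply/eqP/rowP => i; rewrite mxE.
have -> : v 0 i = f (enum_val i) by rewrite /f enum_valK mxE.
case: (eqVneq (enum_val i) s0) => [->//|is0].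
by have := fc (enum_val i) s0; rewrite /pointed eqxx (negPf is0) !subr0.
Qed.

Lemma poisson_solP Q s0 r :
  stochastic Q -> single_recurrent_class Q ->
  poisson Q r (poisson_sol Q s0 r s0) (pointed s0 (poisson_sol Q s0 r)).
Proof.
move=> Qs Q1 s; have := mul_poisson_mx Q s0
  ((\det (poisson_mx Q s0))^-1 *: (\adj (poisson_mx Q s0) *m \col_i r (enum_val i))) s.
rewrite -scalemxAr mulmxA mul_mx_adj mul_scalar_mx scalerA mulVf ?scale1r; last first.
  by rewrite -unitfE -unitmxE poisson_mx_unit.
rewrite mxE enum_rankK => /= ->.
by rewrite /poisson_sol subrK.
Qed.

(** * Stationary distributions *)

Lemma sum_delta (d : S -> R) s : \sum_t d t * (t == s)%:R = d s.
Proof.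
rewrite (bigD1 s) //= eqxx mulr1 big1 ?addr0 // => t /negPf ->.
by rewrite mulr0.
Qed.

Lemma stationary_mean Q mu d :
  stationary Q mu -> \sum_s mu s * mean Q d s = \sum_s mu s * d s.
Proof.
move=> [_ [_ muQ]]; rewrite /mean; under eq_bigr do rewrite mulr_sumr.
rewrite exchange_big; apply: eq_bigr => t _ /=; rewrite -muQ mulr_suml.
by apply: eq_bigr => s _; rewrite mulrA.
Qed.

Lemma stationary_gain Q mu r h d :
  stationary Q mu -> poisson Q r h d -> \sum_s mu s * r s = h.
Proof.
move=> mus pois; have := stationary_mean d mus.
have [_ [mu1 _]] := mus => E.
have : \sum_s mu s * (h + d s) = \sum_s mu s * (r s + mean Q d s).
  by apply: eq_bigr => s _; rewrite pois.
under eq_bigr do rewrite mulrDr.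
under [in X in _ = X]eq_bigr do rewrite mulrDr.
by rewrite !big_split /= E -mulr_suml mu1 mul1r => /addIr.
Qed.

(** The mass of [s] is the gain of the indicator reward of [s], which does not depend on the
    distribution. *)
Lemma stationary_unique Q mu mu' :
  stochastic Q -> single_recurrent_class Q ->
  stationary Q mu -> stationary Q mu' -> forall s, mu s = mu' s.
Proof.
move=> Qs Q1 mus mus' s.
have pois := poisson_solP s (fun t => (t == s)%:R) Qs Q1.
by rewrite -sum_delta (stationary_gain mus pois) -(stationary_gain mus' pois) sum_delta.
Qed.

(** The stationary distribution is the linear functional sending a reward to
    its gain. *)
Lemma stationary_exists (s0 : S) Q :
  stochastic Q -> single_recurrent_class Q -> exists mu, stationary Q mu.
Proof.
move=> Qs Q1; pose delta s (t : S) : R := (t == s)%:R.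
exists (fun s => poisson_sol Q s0 (delta s) s0).
(* Superposing the solutions for the indicator rewards gives one for [r], and gains are unique. *)
have lin r h d : poisson Q r h d ->
    \sum_s r s * poisson_sol Q s0 (delta s) s0 = h.
  move=> pois.
  have pois' : poisson Q r (\sum_s r s * poisson_sol Q s0 (delta s) s0)
      (fun t => \sum_s r s * pointed s0 (poisson_sol Q s0 (delta s)) t).
    move=> t; rewrite /mean; under [in RHS]eq_bigr do rewrite mulr_sumr.
    rewrite exchange_big -big_split -[X in X + _](sum_delta r) -big_split /=.
    apply: eq_bigr => s _; rewrite -mulrDr poisson_solP // mulrDr.
    rewrite /delta eq_sym; congr (_ + _); rewrite mulr_sumr.
    by apply: eq_bigr => u _; rewrite mulrCA.
  by have [] := poisson_unique s0 Qs Q1 pois' pois.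
split=> [s|]; first by apply: (poisson_gain_ge0 s0 Qs (poisson_solP s0 _ Qs Q1)).
split.
  rewrite -[RHS](lin (fun=> 1) 1 (fun=> 0)) => [|s]; last by rewrite mean_cst.
  by apply: eq_bigr => s _; rewrite mul1r.
move=> s'.
suff : \sum_s (Q s s' - delta s' s) * poisson_sol Q s0 (delta s) s0 = 0.
  under eq_bigr do rewrite mulrBl.
  rewrite sumrB => /eqP; rewrite subr_eq0 => /eqP.
  under eq_bigr do rewrite mulrC.
  move=> ->; under eq_bigr do rewrite mulrC.
  exact: sum_delta.
(* Invariance is the statement that this reward has gain [0], witnessed by the negated indicator of
   [s'] as bias. *)
apply: (lin (fun s => Q s s' - delta s' s) 0 (fun t => - delta s' t)) => s.
by rewrite meanN /mean sum_delta; lra.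
Qed.

Lemma stationary_closed Q mu :
  stochastic Q -> stationary Q mu -> closed_set Q [set s | 0 < mu s].
Proof.
move=> Qs [mu0 [_ muQ]] s s'; rewrite !inE => mus Qss'.
rewrite -muQ (bigD1 s) //= ltr_pwDl ?mulr_gt0 //.
by apply: sumr_ge0 => t _; apply: mulr_ge0 => //; case: (Qs t).
Qed.

Lemma stationary_null Q mu d :
  stationary Q mu -> (forall s, 0 <= d s) -> \sum_s mu s * d s = 0 ->
  forall s, 0 < mu s -> d s = 0.
Proof.
move=> [mu0 _] d0 /eqP; rewrite psumr_eq0 => [/allP sum0 s mus|s _]; last first.
  exact: mulr_ge0.
have := sum0 s (mem_index_enum _); rewrite /= mulf_eq0 gt_eqF //=.
by move=> /eqP.
Qed.

Lemma stationary_support Q mu : stationary Q mu -> exists s, 0 < mu s.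
Proof.
move=> [mu0 [mu1 _]]; case: (boolP [exists s, 0 < mu s]) => [/existsP//|].
rewrite negb_exists => /forallP mule0.
move: mu1; rewrite big1 => [/eqP|s _]; first by rewrite eq_sym oner_eq0.
by apply/eqP; rewrite eq_le mu0 leNgt mule0.
Qed.

(** Integrating against [mu] shows that [d] is harmonic on the support of [mu]. That support is
    closed, so [d] is constant there, equal to its global minimum, which is therefore the
    [mu]-average. *)
Lemma superharmonic_ge_stationary Q mu d :
  stochastic Q -> single_recurrent_class Q -> stationary Q mu ->
  (forall s, mean Q d s <= d s) -> forall s, \sum_t mu t * d t <= d s.
Proof.
move=> Qs Q1 mus sup s; have [x0 x0mu] := stationary_support mus.
have harm t : 0 < mu t -> d t - mean Q d t = 0.
  apply: (@stationary_null Q mu (fun t => d t - mean Q d t)) => // [u|].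
    by rewrite subr_ge0.
  under eq_bigr do rewrite mulrBr.
  by rewrite sumrB stationary_mean // subrr.
have [|||x [xmin xmax]] := superharmonic_subharmonic_meet (d := d) (x0 := s)
  (y0 := x0) Qs Q1 (@closed_setT Q) (stationary_closed Qs mus) (in_setT _).
- by rewrite inE.
- by move=> t _; apply: sup.
- by move=> t; rewrite inE => /harm /eqP; rewrite subr_eq0 => /eqP <-.
have [mu0 [mu1 _]] := mus.
suff -> : \sum_t mu t * d t = d x by apply: xmin; rewrite inE.
rewrite -[RHS]mul1r -mu1 mulr_suml; apply: eq_bigr => t _.
have := mu0 t; rewrite le_eqVlt => /predU1P[<-|mut]; first by rewrite !mul0r.
by congr (_ * _); apply/eqP; rewrite eq_le xmin ?xmax ?inE.
Qed.

Lemma stationary_local Q Q' mu :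
  (forall s s', 0 < mu s -> Q s s' = Q' s s') -> stationary Q mu -> stationary Q' mu.
Proof.
move=> QQ' [mu0 [mu1 muQ]]; split=> //; split=> // s'; rewrite -muQ.
apply: eq_bigr => s _; have := mu0 s; rewrite le_eqVlt => /predU1P[<-|mus].
  by rewrite !mul0r.
by rewrite QQ'.
Qed.

End Chain.

(** * Bias optimality and the Bellman equation *)

Section MDP.
Variables (R : realType) (S : finType).
Variables (P : bool -> S -> S -> R) (r : bool -> S -> R).
Hypotheses (Pst : row_stochastic P) (Puni : unichain P).
Implicit Types (lam g : R) (b : S -> R) (pi : {set S}) (s : S) (a : bool).

Definition qval lam b a s := (if a then r true s - lam else r false s) + mean (P a) b s.

(** The Bellman optimality equation, with [pi] attaining the maximum. Unlike [BO_with], it leaves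
    [b] free up to an additive constant, to which advantages are insensitive. *)
Definition bellman lam pi g b :=
  poisson (Ppol P pi) (rpol r lam pi) g b /\ forall s a, qval lam b a s <= g + b s.

Lemma rpol_mean lam pi b s :
  rpol r lam pi s + mean (Ppol P pi) b s = qval lam b (s \in pi) s.
Proof. by []. Qed.

Lemma advantageE lam b s : advantage P r lam b s = qval lam b true s - qval lam b false s.
Proof.
rewrite /advantage /qval /mean; under eq_bigr do rewrite mulrBl.
by rewrite sumrB; lra.
Qed.

Lemma Ppol_stochastic pi : stochastic (Ppol P pi).
Proof. by move=> s; apply: Pst. Qed.

Lemma P_stochastic a : stochastic (P a).
Proof. by move=> s; apply: Pst. Qed.

Let inhabitant : exists s : S, True.
Proof. by have [[s _] _] := Puni set0; exists s. Qed.

Lemma advantage_shift lam b b' s :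
  (forall s t, b s - b' s = b t - b' t) -> advantage P r lam b s = advantage P r lam b' s.
Proof.
move=> bb'; rewrite !advantageE.
have E a : qval lam b a s = qval lam b' a s + (b s - b' s).
  rewrite /qval -addrA; congr (_ + _).
  rewrite -[X in _ = _ + X](@mean_cst R S (P a) (b s - b' s) s (P_stochastic a)).
  rewrite [X in _ = _ + X](@eq_mean R S (P a) _ (fun t => b t - b' t)) //.
  by rewrite meanB addrC subrK.
by rewrite !E; lra.
Qed.

Lemma gain_bias_exists lam pi : exists g b, gain_bias P r lam pi g b.
Proof.
have [s0 _] := inhabitant; have Qs := Ppol_stochastic pi.
have pois := poisson_solP s0 (rpol r lam pi) Qs (Puni pi).
have [mu mus] := stationary_exists s0 Qs (Puni pi).
set d := pointed _ _ in pois; pose c := \sum_s mu s * d s.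
exists (poisson_sol (Ppol P pi) s0 (rpol r lam pi) s0), (fun s => d s - c).
split; first exact: (poisson_shift c Qs pois).
exists mu; split=> //; under eq_bigr do rewrite mulrBr.
by rewrite sumrB -mulr_suml; case: mus => _ [-> _]; rewrite mul1r subrr.
Qed.

Lemma gain_bias_poisson lam pi g b :
  gain_bias P r lam pi g b -> poisson (Ppol P pi) (rpol r lam pi) g b.
Proof. by case. Qed.

Lemma gain_bias_mean lam pi g b mu :
  gain_bias P r lam pi g b -> stationary (Ppol P pi) mu -> \sum_s mu s * b s = 0.
Proof.
move=> [_ [mu' [mus' mub]]] mus; rewrite -[RHS]mub; apply: eq_bigr => s _.
by rewrite (stationary_unique (Ppol_stochastic pi) (Puni pi) mus mus').
Qed.

Lemma gain_bias_unique lam pi g b g' b' :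
  gain_bias P r lam pi g b -> gain_bias P r lam pi g' b' ->
  g = g' /\ forall s, b s = b' s.
Proof.
move=> gb gb'; have [s0 _] := inhabitant.
have Qs := Ppol_stochastic pi.
have [-> bb'] := poisson_unique s0 Qs (Puni pi)
  (gain_bias_poisson gb) (gain_bias_poisson gb').
split=> // s; have [mu mus] := stationary_exists s0 Qs (Puni pi).
have : \sum_t mu t * (b t - b' t) = b s - b' s.
  under eq_bigr do rewrite (bb' _ s).
  by rewrite -mulr_suml; case: mus => _ [-> _]; rewrite mul1r.
under eq_bigr do rewrite mulrBr.
rewrite sumrB (gain_bias_mean gb mus) (gain_bias_mean gb' mus) subrr.
by move=> /esym/eqP; rewrite subr_eq0 => /eqP.
Qed.

(** Howard's policy improvement. When the gain does not increase, the switched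
    states are transient for the new policy, so both policies have the same
    stationary distribution and their normalised biases can be compared. *)
Lemma policy_improvement lam pi g b s a :
  gain_bias P r lam pi g b -> g + b s < qval lam b a s ->
  exists pi' g' b', gain_bias P r lam pi' g' b' /\
    (g < g' \/ g' = g /\ (forall t, b t <= b' t) /\ b s < b' s).
Proof.
move=> gb imp; have [s0 _] := inhabitant.
(* [sw] marks the states where the other action is strictly better; [pi'] switches all of them at
   once. *)
pose sw t := g + b t < qval lam b (t \notin pi) t.
pose pi' := [set t | (t \in pi) (+) sw t].
have [g' [b' gb']] := gain_bias_exists lam pi'.
exists pi', g', b'; split=> //.
have pois t : g + b t = qval lam b (t \in pi) t := gain_bias_poisson gb t.
have Qs := Ppol_stochastic pi'.
(* The one-step improvement [e] serves as a reward: under [pi'] its gain is [g' - g] and [b' - b]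
   solves its Poisson equation. *)
pose e t := qval lam b (t \in pi') t - (g + b t).
have e_sw t : sw t -> 0 < e t.
  by move=> swt; rewrite /e inE swt addbT subr_gt0.
have e_nsw t : ~~ sw t -> e t = 0.
  by move=> /negPf swt; rewrite /e inE swt addbF -pois subrr.
have e_ge0 t : 0 <= e t by case: (boolP (sw t)) => [/e_sw/ltW//|/e_nsw->].
have sws : sw s.
  rewrite /sw; case: (eqVneq a (s \in pi)) imp => [->|]; first by rewrite -pois ltxx.
  by case: a; case: (s \in pi).
have [mu mus] := stationary_exists s0 Qs (Puni pi').
have pe : poisson (Ppol P pi') e (g' - g) (fun t => b' t - b t).
  move=> t; rewrite meanB; have := gain_bias_poisson gb' t.
  by rewrite /e -rpol_mean; lra.
have mue := stationary_gain mus pe.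
have : 0 <= g' - g by apply: (poisson_gain_ge0 s0 Qs pe).
rewrite subr_ge0 le_eqVlt => /predU1P[gg'|]; last by left.
right; split=> //; rewrite -gg' subrr in pe mue.
have mu_nsw t : 0 < mu t -> ~~ sw t.
  move=> mut; apply/negP => /e_sw; rewrite (stationary_null mus e_ge0 mue mut).
  by rewrite ltxx.
have mus' : stationary (Ppol P pi) mu.
  apply: stationary_local mus => t t' /mu_nsw/negPf swt.
  by rewrite /Ppol inE swt addbF.
have sup t : mean (Ppol P pi') (fun u => b' u - b u) t <= b' t - b t.
  by have := pe t; have := e_ge0 t; lra.
have ge0 t : 0 <= b' t - b t.
  apply: le_trans (superharmonic_ge_stationary Qs (Puni pi') mus sup t).
  under eq_bigr do rewrite mulrBr.
  by rewrite sumrB (gain_bias_mean gb' mus) (gain_bias_mean gb mus') subrr.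
split=> [t|]; first by rewrite -subr_ge0.
rewrite -subr_gt0; have := pe s; have := e_sw s sws.
have := @mean_ge R S _ 0 _ s Qs ge0; lra.
Qed.

Lemma BO_bellman lam pi g b : BO_with P r lam pi g b -> bellman lam pi g b.
Proof.
move=> [gb [gmax bmax]]; split=> [|s a]; first exact: gain_bias_poisson.
rewrite leNgt; apply/negP => /(policy_improvement gb)[pi' [g' [b' [gb' []]]]].
  by rewrite ltNge (gmax _ _ _ gb').
by move=> [gg' [_]]; rewrite ltNge (bmax _ _ _ gb' gg').
Qed.

(** When the gains agree, [b' - b] is subharmonic for [pi']. Exchanging the roles of two optimal
    policies makes it superharmonic for [pi]. *)
Lemma bellman_subharmonic lam pi g b pi' g' b' s :
  bellman lam pi g b -> poisson (Ppol P pi') (rpol r lam pi') g' b' ->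
  g' - g + (b' s - b s) <= mean (Ppol P pi') (fun t => b' t - b t) s.
Proof.
move=> [_ opt] pois'; rewrite meanB; have := pois' s; have := opt s (s \in pi').
by rewrite -rpol_mean; lra.
Qed.

Lemma bellman_gain_max lam pi g b pi' g' b' :
  bellman lam pi g b -> poisson (Ppol P pi') (rpol r lam pi') g' b' -> g' <= g.
Proof.
move=> bell pois'; have [s0 _] := inhabitant.
case: (arg_maxP (fun t => b' t - b t) (erefl (xpredT s0))) => x _ maxx.
have := @bellman_subharmonic _ _ _ _ _ _ _ x bell pois'.
have := @mean_le R S _ (b' x - b x) (fun t => b' t - b t) x (Ppol_stochastic pi')
  (fun t => maxx t erefl).
lra.
Qed.

(** Where [b' - b] is maximal (resp. minimal) is closed under [pi'] (resp.
    [pi]); were these sets disjoint, a policy following [pi'] on the first and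
    [pi] on the second would have two recurrent classes. *)
Lemma bellman_bias_unique lam pi g b pi' g' b' :
  bellman lam pi g b -> bellman lam pi' g' b' ->
  forall s t, b s - b' s = b t - b' t.
Proof.
move=> bell bell'; have [s0 _] := inhabitant.
have gg' : g' = g.
  apply/le_anti/andP; split; first exact: bellman_gain_max bell bell'.1.
  exact: bellman_gain_max bell' bell.1.
rewrite {}gg' in bell'.
pose d t := b' t - b t.
have sub t : d t <= mean (Ppol P pi') d t.
  by have := bellman_subharmonic t bell bell'.1; rewrite subrr add0r.
have sup t : mean (Ppol P pi) d t <= d t.
  have := bellman_subharmonic t bell' bell.1.
  by rewrite subrr add0r !meanB /d; lra.
case: (arg_maxP d (erefl (xpredT s0))) => x _ maxx.
case: (arg_minP d (erefl (xpredT s0))) => y _ miny.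
suff dxy : d x = d y.
  move=> s t; have dx u : d u = d x.
    by apply/le_anti/andP; split; [apply: maxx | rewrite dxy; apply: miny].
  by have := dx s; have := dx t; rewrite /d; lra.
apply/eqP; apply: contraT => dxy.
pose sg := [set t | if d t == d x then t \in pi' else t \in pi].
have clx : closed_set (Ppol P sg) [set t in setT | d t == d x].
  have := argmax_closed (m := d x) (d := d) (Ppol_stochastic pi')
    (@closed_setT R S (Ppol P pi')).
  move=> H t t' tx; rewrite /Ppol.
  have -> : (t \in sg) = (t \in pi').
    by move: tx; rewrite !inE /= => ->.
  apply: (H _ _ t t' tx) => [u _|u _ <-]; first exact: maxx.
  exact: sub.
have cly : closed_set (Ppol P sg) [set t in setT | d t == d y].
  have := argmin_closed (m := d y) (d := d) (Ppol_stochastic pi)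
    (@closed_setT R S (Ppol P pi)).
  move=> H t t' ty; rewrite /Ppol.
  have -> : (t \in sg) = (t \in pi).
    by move: ty; rewrite !inE /= => /eqP ->; rewrite eq_sym (negPf dxy).
  apply: (H _ _ t t' ty) => [u _|u _ <-]; first exact: miny.
  exact: sup.
have [| |z] := closed_sets_meet (x := x) (y := y) (Puni sg) clx cly.
- by rewrite !inE eqxx.
- by rewrite !inE eqxx.
by rewrite !inE => /eqP -> /=; rewrite (negPf dxy).
Qed.

(** Among the finitely many policies of maximal gain, take one whose bias has the largest sum over
    the states. Policy improvement yields the Bellman equation, and comparison with each
    gain-optimal policy then upgrades the maximal sum to pointwise maximality. *)
Lemma BO_exists lam : exists pi g b, BO_with P r lam pi g b.
Proof.
have [f gbf] : {f : {set S} -> R * (S -> R) &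
    forall pi, gain_bias P r lam pi (f pi).1 (f pi).2}.
  apply: (choice (P := fun pi h => gain_bias P r lam pi h.1 h.2)) => pi.
  have [g [b gb]] := gain_bias_exists lam pi.
  by exists (g, b).
case: (arg_maxP (fun pi => (f pi).1) (erefl (xpredT (set0 : {set S})))) => p1 _ maxg.
pose F pi := \sum_s (f pi).2 s.
case: (arg_maxP F (i0 := p1) (P := fun pi => (f pi).1 == (f p1).1)) => // pi.
move=> /eqP gpi maxb.
have gmax pi' g' b' : gain_bias P r lam pi' g' b' -> g' <= (f pi).1.
  by move=> /gain_bias_unique /(_ (gbf pi'))[-> _]; rewrite gpi; apply: maxg.
have bmax pi' g' b' : gain_bias P r lam pi' g' b' -> g' = (f pi).1 ->
    \sum_s b' s <= F pi.
  move=> /gain_bias_unique /(_ (gbf pi'))[-> bf] gg'.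
  under eq_bigr do rewrite bf.
  by apply: maxb; rewrite /= gg' gpi.
exists pi, (f pi).1, (f pi).2; set g := (f pi).1 in gmax bmax *.
have gb := gbf pi; set b := (f pi).2 in gb *; rewrite -/g in gb.
have bell : bellman lam pi g b.
  split=> [|s a]; first exact: gain_bias_poisson.
  rewrite leNgt; apply/negP => /(policy_improvement gb)[pi' [g' [b' [gb' []]]]].
    by rewrite ltNge (gmax _ _ _ gb').
  move=> [gg' [ble blt]]; have := bmax _ _ _ gb' gg'; apply/negP; rewrite -ltNge.
  rewrite /F (bigD1 s) //= [ltRHS](bigD1 s) //=; apply: ltr_leD => //.
  exact: ler_sum.
split=> //; split=> // pi2 g2 b2 gb2 gg2 s; rewrite {}gg2 in gb2.
have [mu mus] := stationary_exists s (Ppol_stochastic pi2) (Puni pi2).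
(* The loss [e] of [pi2] against the Bellman equation has gain [0], so it vanishes on the support of
   the stationary distribution [mu] of [pi2]. *)
pose e t := g + b t - qval lam b (t \in pi2) t.
have e_ge0 t : 0 <= e t by rewrite subr_ge0; apply: bell.2.
have pe : poisson (Ppol P pi2) e 0 (fun t => b t - b2 t).
  move=> t; rewrite meanB; have := gain_bias_poisson gb2 t.
  by rewrite /e -rpol_mean; lra.
have e0 := stationary_null mus e_ge0 (stationary_gain mus pe).
(* Following [pi2] on the support of [mu] and [pi] elsewhere keeps the gain [g] and has normalised
   bias [b - c]. Maximality of the sum for [pi] then forces [c] to be nonnegative. *)
pose sg := [set t | if 0 < mu t then t \in pi2 else t \in pi].
have mus' : stationary (Ppol P sg) mu.
  by apply: stationary_local mus => t t' mut; rewrite /Ppol inE mut.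
pose c := \sum_t mu t * b t.
have gbs : gain_bias P r lam sg g (fun t => b t - c).
  split.
    apply: (poisson_shift c (Ppol_stochastic sg)) => t.
    rewrite rpol_mean inE; case: ifP => [/e0/eqP|_]; last exact: bell.1.
    by rewrite subr_eq0 => /eqP.
  exists mu; split=> //; under eq_bigr do rewrite mulrBr.
  by rewrite sumrB -mulr_suml; case: mus => _ [-> _]; rewrite mul1r subrr.
have c_ge0 : 0 <= c.
  have := bmax _ _ _ gbs erefl; rewrite /F sumrB gerBl sumr_const.
  rewrite pmulrn_lge0 //; apply/card_gt0P; by exists s.
rewrite -subr_ge0.
have sup t : mean (Ppol P pi2) (fun u => b u - b2 u) t <= b t - b2 t.
  by have := pe t; have := e_ge0 t; lra.
apply: le_trans (superharmonic_ge_stationary (Ppol_stochastic pi2) (Puni pi2) mus sup s).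
under eq_bigr do rewrite mulrBr.
by rewrite sumrB (gain_bias_mean gb2 mus) subr0.
Qed.

(** Any solution of the Bellman equation computes the optimal advantage, so later arguments need not
    establish bias optimality of a given policy. *)
Lemma opt_advantage_bellman lam pi g b s x :
  bellman lam pi g b -> opt_advantage P r lam s x -> x = advantage P r lam b s.
Proof.
move=> bell [pi' [g' [b' [/BO_bellman bell' ->]]]].
by apply: advantage_shift; apply: bellman_bias_unique bell' bell.
Qed.

Lemma opt_advantage_exists lam :
  exists pi g b, bellman lam pi g b /\
    forall s, opt_advantage P r lam s (advantage P r lam b s).
Proof.
have [pi [g [b bo]]] := BO_exists lam.
by exists pi, g, b; split=> [|s]; [apply: BO_bellman | exists pi, g, b].
Qed.

End MDP.

(** * Dependence on the penalty and on the transitions *)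

Local Open Scope classical_set_scope.

Section FiniteLimits.
Context {R : realType} {T : Type} {F : set_system T} {FF : Filter F}.

Lemma cvg_sumr (I : finType) (f : I -> T -> R) (l : I -> R) :
  (forall i, f i @ F --> l i) -> \sum_i f i x @[x --> F] --> \sum_i l i.
Proof. by move=> fl; apply: cvg_big => //; apply: add_continuous. Qed.

Lemma cvg_prodr (I : finType) (f : I -> T -> R) (l : I -> R) :
  (forall i, f i @ F --> l i) -> \prod_i f i x @[x --> F] --> \prod_i l i.
Proof. by move=> fl; apply: cvg_big => //; apply: mul_continuous. Qed.

Lemma cvg_det n (A : T -> 'M[R]_n) (B : 'M[R]_n) :
  (forall i j, A x i j @[x --> F] --> B i j) -> \det (A x) @[x --> F] --> \det B.
Proof.
move=> AB; rewrite /determinant; apply: cvg_sumr => s.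
by apply: cvgM; [apply: cvg_cst | apply: cvg_prodr => i].
Qed.

Lemma cvg_adj n (A : T -> 'M[R]_n) (B : 'M[R]_n) :
  (forall i j, A x i j @[x --> F] --> B i j) ->
  forall i j, \adj (A x) i j @[x --> F] --> \adj B i j.
Proof.
move=> AB i j; rewrite mxE; under eq_cvg do rewrite mxE.
apply: cvgM; first exact: cvg_cst.
apply: cvg_det => k l; rewrite !mxE; under eq_cvg do rewrite !mxE.
exact: AB.
Qed.

End FiniteLimits.

Section Affine.
Variables (R : realType) (S : finType) (r : bool -> S -> R) (s0 : S).
Implicit Types (P : bool -> S -> S -> R) (pi : {set S}).

(** The reward of [pi] is affine in the penalty, with the indicator of [pi] subtracted [lam] times.
    By linearity its bias pinned at [s0] is [bias_const - lam * bias_slope]. *)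
Definition bias_const P pi := pointed s0 (poisson_sol (Ppol P pi) s0 (rpol r 0 pi)).

Definition bias_slope P pi :=
  pointed s0 (poisson_sol (Ppol P pi) s0 (fun s => (s \in pi)%:R)).

Definition adv_const P pi s :=
  r true s - r false s + (mean (P true) (bias_const P pi) s
                          - mean (P false) (bias_const P pi) s).

(** Minus the derivative of the advantage in the penalty: a positive [adv_slope] means a decreasing
    advantage. *)
Definition adv_slope P pi s :=
  1 + (mean (P true) (bias_slope P pi) s - mean (P false) (bias_slope P pi) s).

Lemma advantage_affine P lam pi g b s :
  row_stochastic P -> unichain P -> poisson (Ppol P pi) (rpol r lam pi) g b ->
  advantage P r lam b s = adv_const P pi s - lam * adv_slope P pi s.
Proof.
move=> Pst Puni pois; have Qs := Ppol_stochastic Pst pi.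
have pu := poisson_solP s0 (rpol r 0 pi) Qs (Puni pi).
have pv := poisson_solP s0 (fun s => (s \in pi)%:R) Qs (Puni pi).
have puv := poissonB pu (poissonZ lam pv).
have [|_ bE] := poisson_unique s0 Qs (Puni pi) pois
  (eq_poisson (r' := rpol r lam pi) _ puv).
  by move=> t; rewrite /rpol; case: (t \in pi); rewrite ?mulr1 ?mulr0 ?subr0.
rewrite (advantage_shift r Pst lam s bE) advantageE /qval !meanB !meanZ.
by rewrite /adv_const /adv_slope /bias_const /bias_slope; lra.
Qed.

(** If [pi] is empty or full, its indicator is a constant reward, so the bias does not vary with the
    penalty. *)
Lemma adv_slope_const P c pi s :
  row_stochastic P -> unichain P -> (forall s, (s \in pi) = c) -> adv_slope P pi s = 1.
Proof.
move=> Pst Puni pic; have Qs := Ppol_stochastic Pst pi.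
have pv := poisson_solP s0 (fun s => (s \in pi)%:R) Qs (Puni pi).
have [|_ vc] := poisson_unique s0 Qs (Puni pi) pv (h' := c%:R) (d' := fun=> 0).
  by move=> t; rewrite mean_cst // pic.
have vE t : bias_slope P pi t = 0.
  by have := vc t s0; rewrite /bias_slope /pointed eqxx !subr0.
rewrite /adv_slope -(@eq_mean _ _ _ (fun=> 0)) // -(@eq_mean _ _ _ (fun=> 0)) //.
by rewrite !mean_cst ?subrr ?addr0 // => t; apply: Pst.
Qed.

(** The admissible perturbations of [P], packed as a filter. Finitely many strict inequalities can
    then be obtained from limits and intersected, and a single [delta] is read off at the end. *)
Definition mdp_nbhs P : set_system (bool -> S -> S -> R) :=
  [set A | exists2 delta, 0 < delta & forall Ph, row_stochastic Ph ->
     same_support P Ph -> dist_le P Ph delta -> A Ph].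

Lemma mdp_nbhs_filter P : Filter (mdp_nbhs P).
Proof.
split=> [|A B [d d0 Ad] [e e0 Be]|A B AB [d d0 Ad]].
- by exists 1.
- exists (Order.min d e) => [|Ph Phs sup dist]; first by rewrite lt_min d0.
  split; [apply: Ad | apply: Be] => // a s; apply: le_trans (dist a s) _.
    by rewrite ge_min lexx.
  by rewrite ge_min lexx orbT.
- by exists d => // Ph Phs sup dist; apply/AB/Ad.
Qed.

Section Cvg.
Variable P : bool -> S -> S -> R.
Hypotheses (Pst : row_stochastic P) (Puni : unichain P).
Local Notation F := (mdp_nbhs P).
#[local] Instance FF : Filter F := mdp_nbhs_filter P.

Lemma cvg_transition a s t : Ph a s t @[Ph --> F] --> P a s t.
Proof.
apply/cvgrPdist_le => e e0; exists e => // Ph _ _ dist.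
apply: le_trans (dist a s); rewrite (bigD1 t) //= lerDl.
exact: sumr_ge0.
Qed.

Lemma cvg_poisson_mx pi i j :
  poisson_mx (Ppol Ph pi) s0 i j @[Ph --> F] --> poisson_mx (Ppol P pi) s0 i j.
Proof.
rewrite mxE; under eq_cvg do rewrite mxE.
case: ifP => _; first exact: cvg_cst.
by apply: cvgB; [exact: cvg_cst | exact: cvg_transition].
Qed.

(** The quotient passes to the limit because the determinant at [P] is nonzero. *)
Lemma cvg_poisson_sol pi u s :
  pointed s0 (poisson_sol (Ppol Ph pi) s0 u) s @[Ph --> F]
    --> pointed s0 (poisson_sol (Ppol P pi) s0 u) s.
Proof.
rewrite /pointed; case: ifP => _; first exact: cvg_cst.
rewrite /poisson_sol mxE; under eq_cvg do rewrite mxE.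
apply: cvgM.
  apply: cvgV; last by apply: cvg_det; apply: cvg_poisson_mx.
  by rewrite -unitfE -unitmxE poisson_mx_unit //; apply: Ppol_stochastic.
rewrite mxE; under eq_cvg do rewrite mxE.
apply: cvg_sumr => i; apply: cvgM; last by rewrite !mxE; exact: cvg_cst.
by apply: cvg_adj; apply: cvg_poisson_mx.
Qed.

Lemma cvg_mean a (d : (bool -> S -> S -> R) -> S -> R) s :
  (forall t, d Ph t @[Ph --> F] --> d P t) ->
  mean (Ph a) (d Ph) s @[Ph --> F] --> mean (P a) (d P) s.
Proof.
move=> dP; apply: cvg_sumr => t; apply: cvgM; [exact: cvg_transition | exact: dP].
Qed.

Lemma cvg_adv_const pi s : adv_const Ph pi s @[Ph --> F] --> adv_const P pi s.
Proof.
apply: cvgD; first exact: cvg_cst.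
by apply: cvgB; apply: cvg_mean => t; apply: cvg_poisson_sol.
Qed.

Lemma cvg_adv_slope pi s : adv_slope Ph pi s @[Ph --> F] --> adv_slope P pi s.
Proof.
apply: cvgD; first exact: cvg_cst.
by apply: cvgB; apply: cvg_mean => t; apply: cvg_poisson_sol.
Qed.

End Cvg.
End Affine.

(** * Crossings and indices *)

(** Reachability, hence recurrence, depends only on which transitions are positive. *)
Lemma unichain_same_support (R : realType) (S : finType) (P Ph : bool -> S -> S -> R) :
  same_support P Ph -> unichain P -> unichain Ph.
Proof.
move=> sup Puni pi.
have E s s' : reach (Ppol Ph pi) s s' = reach (Ppol P pi) s s'.
  apply: eq_connect => t t' /=; rewrite /Ppol.
  by apply/idP/idP => /sup.
have recE s : recurrent (Ppol Ph pi) s <-> recurrent (Ppol P pi) s.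
  by split=> rec s'; move: (rec s'); rewrite !E.
have [[s rec] rec1] := Puni pi; split; first by exists s; apply/recE.
by move=> t t' /recE tr /recE tr'; rewrite E; apply: rec1.
Qed.

Section RealFacts.
Variable R : realType.
Implicit Types u v l p q e : R.

(** Meant for consecutive crossings [u] and [v] around [l]. The inequality at [v] is weak because
    the advantage of the state crossing there vanishes. *)
Lemma affine_gt0 u v l p q :
  u <= l -> l < v -> 0 < p - u * q -> 0 <= p - v * q -> 0 < p - l * q.
Proof.
move=> ul lv fu fv; case: (lerP q 0) => q0.
  by have := ler_wnM2r q0 ul; lra.
by have : l * q < v * q; [rewrite ltr_pM2r | lra].
Qed.

(** Now the value at [u] may vanish. Since [l] may equal [u], strictness in that case is a separate
    premise. *)
Lemma affine_lt0 u v l p q :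
  u <= l -> l < v -> p - u * q <= 0 -> p - v * q < 0 ->
  (u = l -> p - u * q < 0) -> p - l * q < 0.
Proof.
move=> ul lv fu fv ful; case: (eqVneq u l) => [E|neq]; first by rewrite -E; apply: ful.
have {}ul : u < l by rewrite lt_neqAle neq.
case: (lerP q 0) => q0; first by have := ler_wnM2r q0 (ltW lv); lra.
by have : u * q < l * q; [rewrite ltr_pM2r | lra].
Qed.

Lemma affine_right_limit e p q :
  0 < e -> (forall h, 0 < h -> h < e -> 0 < p + h * q) -> 0 <= p.
Proof.
move=> e0 pos; rewrite leNgt; apply/negP => p0.
case: (lerP q 0) => q0.
  have e2 : 0 < e / 2 by lra.
  have := pos (e / 2) e2; have := mulr_ge0_le0 (ltW e2) q0; lra.
(* [- p / q] is the zero of the affine function, which is not positive up to that point. *)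
pose h := Order.min (e / 2) (- p / q).
have h0 : 0 < h by rewrite lt_min; apply/andP; split; [lra | rewrite divr_gt0 // oppr_gt0].
have he : h < e by rewrite gt_min; apply/orP; left; lra.
have : h * q <= - p / q * q by rewrite ler_pM2r // ge_min lexx orbT.
rewrite divfK ?gt_eqF //; have := pos h h0 he; lra.
Qed.

Lemma finite_gap (S : finType) (f : S -> R) :
  exists2 e, 0 < e & forall s t, f s < f t -> e <= f t - f s.
Proof.
(* The default [1] keeps the gap positive when [f] is constant. *)
exists (\big[Order.min/1]_(p : S * S | f p.1 < f p.2) (f p.2 - f p.1)).
  by apply: lt_bigmin => // p; rewrite subr_gt0.
by move=> s t st; apply: (bigmin_inf (s, t)).
Qed.

End RealFacts.

Section Signs.
Variables (R : realType) (S : finType).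
Variables (P : bool -> S -> S -> R) (r : bool -> S -> R).
Hypotheses (Pst : row_stochastic P) (Puni : unichain P).
Variable s0 : S.
Implicit Types (l g : R) (b : S -> R) (pi : {set S}) (s t : S).

Local Notation adv pi l s := (adv_const r s0 P pi s - l * adv_slope s0 P pi s).

Lemma bellman_of_advantage l pi g b :
  poisson (Ppol P pi) (rpol r l pi) g b ->
  (forall s, if s \in pi then 0 <= advantage P r l b s else advantage P r l b s <= 0) ->
  bellman P r l pi g b.
Proof.
move=> pois sgn; split=> // s a; rewrite (pois s) rpol_mean.
have := sgn s; rewrite advantageE.
by case: a; case: (s \in pi); rewrite ?lexx ?subr_ge0 ?subr_le0.
Qed.

(** A policy that follows the signs of the optimal advantages picks a maximising action everywhere,
    so the same [g] and [b] solve its Poisson equation. *)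
Lemma bellman_greedy l pi g b pi' :
  bellman P r l pi g b ->
  (forall s, if s \in pi' then 0 <= advantage P r l b s else advantage P r l b s <= 0) ->
  poisson (Ppol P pi') (rpol r l pi') g b.
Proof.
move=> [pois opt] sgn s; rewrite rpol_mean; apply/le_anti/andP; split; last exact: opt.
rewrite (pois s) rpol_mean; have := sgn s; rewrite advantageE.
by case: (s \in pi); case: (s \in pi'); rewrite ?lexx ?subr_ge0 ?subr_le0.
Qed.

Lemma bellman_of_affine l pi :
  (forall s, if s \in pi then 0 <= adv pi l s else adv pi l s <= 0) ->
  exists g b, bellman P r l pi g b /\ forall s, advantage P r l b s = adv pi l s.
Proof.
move=> sgn; have [g [b gb]] := gain_bias_exists r Pst Puni l pi.
have advE s : advantage P r l b s = adv pi l s.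
  exact: advantage_affine (gain_bias_poisson gb).
exists g, b; split=> //; apply: bellman_of_advantage (gain_bias_poisson gb) _ => s.
by rewrite advE; apply: sgn.
Qed.

(** Where the advantage of [s] vanishes, its two actions have equal value, so one gain and bias
    serve both policies. This lets the policy change at a crossing without changing the
    advantages. *)
Lemma adv_indifferent l pi pi' s :
  (forall t, t != s -> (t \in pi) = (t \in pi')) -> adv pi l s = 0 ->
  forall t, adv pi' l t = adv pi l t.
Proof.
move=> pipi' adv0 t; have [g [b gb]] := gain_bias_exists r Pst Puni l pi.
have pois := gain_bias_poisson gb.
have advE := advantage_affine s0 _ Pst Puni pois.
rewrite -advE -(advantage_affine s0 t Pst Puni (g := g) (b := b)) // => u.
rewrite (pois u) !rpol_mean; case: (eqVneq u s) => [->|us]; last by rewrite pipi'.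
have := adv0; rewrite -advE advantageE => /eqP; rewrite subr_eq0 => /eqP E.
by case: (s \in pi); case: (s \in pi').
Qed.

(** On each interval between consecutive candidate indices the same policy is
    optimal: its advantages are affine in the penalty and have the right signs
    at both ends. On the two unbounded intervals the slope is [-1]. *)
Lemma whittle_index_of_crossings (lh : S -> R) :
  injective lh ->
  (forall s, let pi := [set t | lh s <= lh t]%SET in
     adv pi (lh s) s = 0 /\
     forall t, (lh s < lh t -> 0 < adv pi (lh s) t) /\
               (lh t < lh s -> adv pi (lh s) t < 0)) ->
  forall s, whittle_index P r s (lh s).
Proof.
move=> inj cross x l a opt.
pose pi := [set t | l < lh t]%SET.
(* At the last crossing [u] not beyond [l], the policy of the hypothesis is [pi] with [u] added, and
   [u] is indifferent there. *)
have left u : lh u <= l -> (forall t, lh t <= l -> lh t <= lh u) ->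
    forall t, (l < lh t -> 0 < adv pi (lh u) t) /\
              (lh t <= l -> adv pi (lh u) t <= 0) /\
              (lh t < lh u -> adv pi (lh u) t < 0).
  move=> ul umax t; have [z sgn] := cross u.
  have piE w : w != u -> (w \in [set t | lh u <= lh t]%SET) = (w \in pi).
    rewrite !inE => wu; apply/idP/idP => [|lw]; last exact: le_trans ul (ltW lw).
    rewrite le_eqVlt => /predU1P[/inj uw|]; first by rewrite uw eqxx in wu.
    by apply: contraTT; rewrite -!leNgt; apply: umax.
  rewrite (adv_indifferent piE z); have [sp sn] := sgn t.
  split=> [lt|]; first exact/sp/(le_lt_trans ul).
  split=> // tl; have := umax t tl; rewrite le_eqVlt => /predU1P[/inj->|/sn/ltW//].
  by rewrite z.
(* At the first crossing [v] beyond [l], the policy of the hypothesis is [pi] itself. *)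
have right v : l < lh v -> (forall t, l < lh t -> lh v <= lh t) ->
    forall t, (l < lh t -> 0 <= adv pi (lh v) t) /\
              (lh t <= l -> adv pi (lh v) t < 0).
  move=> lv vmin t; have [z sgn] := cross v.
  have <- : [set t | lh v <= lh t]%SET = pi.
    apply/setP => w; rewrite !inE; apply/idP/idP => [|/vmin//].
    exact: lt_le_trans.
  have [sp sn] := sgn t; split=> [lt|tl]; last exact/sn/(le_lt_trans tl).
  have := vmin t lt; rewrite le_eqVlt => /predU1P[/inj<-|/sp/ltW//].
  by rewrite z.
have sgn t : (l < lh t -> 0 < adv pi l t) /\ (lh t <= l -> adv pi l t <= 0) /\
             (lh t < l -> adv pi l t < 0).
  case: (pickP (fun u => lh u <= l)) => [u0 u0l|noU]; last first.
    (* All crossings exceed [l], so [pi] is full and, with slope [-1], the advantages at [l] exceed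
       those at the first crossing. *)
    have piT w : (w \in pi) = true by rewrite inE ltNge noU.
    have tl : l < lh t by rewrite ltNge noU.
    split=> [_|]; last by split=> H; move: tl; rewrite ltNge ?H ?(ltW H).
    have lx : l < lh x by rewrite ltNge noU.
    case: (arg_minP lh (i0 := x) (P := fun u => l < lh u) lx) => v lv vmin.
    have [+ _] := right v lv vmin t; rewrite (adv_slope_const _ _ Pst Puni piT).
    by move=> /(_ tl); lra.
  case: (arg_maxP lh (i0 := u0) (P := fun u => lh u <= l) u0l) => u ul umax.
  have [lp [ln ls]] := left u ul umax t.
  case: (pickP (fun v => l < lh v)) => [v0 v0l|noV]; last first.
    (* No crossing exceeds [l], so [pi] is empty and the advantages decrease from the last crossing
       to [l]. *)
    have piF w : (w \in pi) = false by rewrite inE noV.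
    have tl : lh t <= l by rewrite leNgt noV.
    move: lp ln ls; rewrite (adv_slope_const _ _ Pst Puni piF) => _ /(_ tl) ln ls.
    split=> [|]; first by rewrite noV.
    split=> [_|tl']; first by lra.
    case: (ltrP (lh t) (lh u)) => [/ls|ut]; first by lra.
    by have := umax t tl; rewrite /= => tu; lra.
  case: (arg_minP lh (i0 := v0) (P := fun v => l < lh v) v0l) => v lv vmin.
  have [rp rn] := right v lv vmin t.
  split=> [lt|]; first exact: affine_gt0 ul lv (lp lt) (rp lt).
  have strict : lh t < l -> adv pi l t < 0.
    move=> tl; have tl' := ltW tl.
    apply: (affine_lt0 ul lv (ln tl') (rn tl')) => ulE; apply: ls.
    by rewrite ulE.
  split=> //; rewrite le_eqVlt => /predU1P[tl|/strict/ltW//].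
  have -> : l = lh u.
    apply/le_anti/andP; split; last exact: ul.
    by rewrite -{1}tl; apply: umax; rewrite /= tl.
  by apply: ln; rewrite tl.
have [|g [b [bell advE]]] := @bellman_of_affine l pi.
  move=> t; have [sp [sn _]] := sgn t; rewrite inE; case: ltrP => [/sp/ltW//|].
  exact: sn.
rewrite (opt_advantage_bellman Pst Puni bell opt) advE.
by have [sp [_ sn]] := sgn x.
Qed.

Variable lam : S -> R.
Hypothesis widx : forall s, whittle_index P r s (lam s).

(** Away from the indices, indexability prescribes the signs of the optimal advantages. The policy
    with these signs is therefore optimal, and its own advantages are the optimal ones. *)
Lemma greedy_signs l pi :
  (forall t, if t \in pi then l < lam t else lam t < l) ->
  forall t, if t \in pi then 0 < adv pi l t else adv pi l t < 0.
Proof.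
move=> piP; have [pi' [g [b [bell opt]]]] := opt_advantage_exists r Pst Puni l.
have sgn t : if t \in pi then 0 < advantage P r l b t else advantage P r l b t < 0.
  have [sp sn] := widx (opt t); have := piP t.
  by case: (t \in pi).
have pois : poisson (Ppol P pi) (rpol r l pi) g b.
  apply: (bellman_greedy bell) => t; have := sgn t.
  by case: (t \in pi) => /ltW.
by move=> t; rewrite -(advantage_affine s0 t Pst Puni pois).
Qed.

(** Just below [lam s] the policy [pi] is optimal, just above it [pi'] is. Both remain optimal in
    the limit, so their advantages at [lam s] coincide, and that of [s] is squeezed to zero. *)
Lemma index_crossing s : let pi := [set t | lam s <= lam t]%SET in
  [/\ adv pi (lam s) s = 0,
      forall t, (lam s < lam t -> 0 < adv pi (lam s) t) /\
                (lam t < lam s -> adv pi (lam s) t < 0) &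
      0 < adv_slope s0 P pi s].
Proof.
move=> pi; pose pi' := [set t | lam s < lam t]%SET.
have [e e0 gap] := finite_gap lam.
(* Below the gap [e], no index lies strictly between [lam s] and [lam s - h], nor between [lam s]
   and [lam s + h]. *)
have left h : 0 < h -> h < e ->
    forall t, if t \in pi then 0 < adv pi (lam s - h) t else adv pi (lam s - h) t < 0.
  move=> h0 he; apply: greedy_signs => t; rewrite inE.
  by case: (lerP (lam s) (lam t)) => [|/gap]; lra.
have right h : 0 < h -> h < e ->
    forall t, if t \in pi' then 0 < adv pi' (lam s + h) t else adv pi' (lam s + h) t < 0.
  move=> h0 he; apply: greedy_signs => t; rewrite inE.
  by case: (ltrP (lam s) (lam t)) => [/gap|]; lra.
have leftw t : if t \in pi then 0 <= adv pi (lam s) t else adv pi (lam s) t <= 0.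
  case: ifP => tpi; last rewrite -oppr_ge0.
    apply: (@affine_right_limit _ e _ (adv_slope s0 P pi t)) => // h h0 he.
    by have := left h h0 he t; rewrite tpi; lra.
  apply: (@affine_right_limit _ e _ (- adv_slope s0 P pi t)) => // h h0 he.
  by have := left h h0 he t; rewrite tpi; lra.
have rightw t : if t \in pi' then 0 <= adv pi' (lam s) t else adv pi' (lam s) t <= 0.
  case: ifP => tpi; last rewrite -oppr_ge0.
    apply: (@affine_right_limit _ e _ (- adv_slope s0 P pi' t)) => // h h0 he.
    by have := right h h0 he t; rewrite tpi; lra.
  apply: (@affine_right_limit _ e _ (adv_slope s0 P pi' t)) => // h h0 he.
  by have := right h h0 he t; rewrite tpi; lra.
have [g [b [bell advE]]] := bellman_of_affine leftw.
have [g' [b' [bell' advE']]] := bellman_of_affine rightw.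
have adv0 : adv pi (lam s) s = 0.
  apply/le_anti/andP; split; last by have := leftw s; rewrite inE lexx.
  have := rightw s; rewrite inE ltxx -advE' -advE.
  by rewrite (advantage_shift r Pst _ _ (bellman_bias_unique Pst Puni bell bell')).
split=> // [t|].
  have [p2 [g2 [b2 [bell2 opt]]]] := opt_advantage_exists r Pst Puni (lam s).
  have := widx (opt t).
  by rewrite (opt_advantage_bellman Pst Puni bell (opt t)) advE.
(* As the advantage of [s] vanishes at [lam s], its positive value at [lam s - e / 2] is [e / 2]
   times the slope. *)
have e2 : 0 < e / 2 by lra.
have := left (e / 2) e2; rewrite ltr_pdivrMr // => /(_ _ s).
rewrite inE lexx mulrBl opprB addrCA adv0.
move=> H; rewrite -(pmulr_rgt0 _ e2).
have /H : e < e * 2 by lra.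
by rewrite addr0.
Qed.

End Signs.

Theorem mainTheorem1 (R : realType) (S : finType)
    (P : bool -> S -> S -> R) (r : bool -> S -> R) :
  row_stochastic P ->
  unichain P ->
  indexable P r ->
  (exists lam : S -> R, (forall s, whittle_index P r s (lam s)) /\ injective lam) ->
  exists delta : R, 0 < delta /\
    forall Ph : bool -> S -> S -> R,
      row_stochastic Ph ->
      same_support P Ph ->
      dist_le P Ph delta ->
      indexable Ph r.
Proof.
move=> Pst Puni _ [lam [widx lam_inj]].
have [[s0 _] _] := Puni set0.
have cross := index_crossing Pst Puni s0 widx.
pose A s := [set t | lam s <= lam t]%SET.
pose p Ph s t := adv_const r s0 Ph (A s) t.
pose q (Ph : bool -> S -> S -> R) s t := adv_slope s0 Ph (A s) t.
have cvp s t : p Ph s t @[Ph --> mdp_nbhs P] --> p P s t by apply: cvg_adv_const.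
have cvq s t : q Ph s t @[Ph --> mdp_nbhs P] --> q P s t by apply: cvg_adv_slope.
have FF := mdp_nbhs_filter P.
have pq s : p P s s = lam s * q P s s.
  by apply/eqP; rewrite -subr_eq0; apply/eqP; case: (cross s).
have q0 s : 0 < q P s s by case: (cross s).
have E1 : \forall Ph \near mdp_nbhs P, forall s, 0 < q Ph s s.
  by apply: filter_forall => s; apply: cvgr_gt (cvq s s) _ _.
(* The perturbed crossing of [s] is [p Ph s s / q Ph s s]. The advantage of [t] there is multiplied
   by [q Ph s s] to clear the denominator, which keeps its sign. *)
have lim s t : p Ph s t * q Ph s s - p Ph s s * q Ph s t @[Ph --> mdp_nbhs P]
    --> (p P s t - lam s * q P s t) * q P s s.
  have -> : (p P s t - lam s * q P s t) * q P s s =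
    p P s t * q P s s - p P s s * q P s t by rewrite pq; ring.
  exact: cvgB (cvgM (cvp s t) (cvq s s)) (cvgM (cvp s s) (cvq s t)).
have E2 : \forall Ph \near mdp_nbhs P, forall s t, lam s < lam t ->
    0 < p Ph s t * q Ph s s - p Ph s s * q Ph s t.
  apply: filter_forall => s; apply: filter_forall => t.
  case: (ltrP (lam s) (lam t)) => [st|_]; last exact: nearW.
  have [_ /(_ t)[/(_ st) sgn _] _] := cross s.
  by apply: filterS (cvgr_gt _ (lim s t) _ (mulr_gt0 sgn (q0 s))) => Ph.
have E3 : \forall Ph \near mdp_nbhs P, forall s t, lam t < lam s ->
    p Ph s t * q Ph s s - p Ph s s * q Ph s t < 0.
  apply: filter_forall => s; apply: filter_forall => t.
  case: (ltrP (lam t) (lam s)) => [ts|_]; last exact: nearW.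
  have [_ /(_ t)[_ /(_ ts) sgn] _] := cross s.
  have neg : (p P s t - lam s * q P s t) * q P s s < 0 by rewrite pmulr_llt0.
  by apply: filterS (cvgr_lt _ (lim s t) _ neg) => Ph.
(* The order of the perturbed crossings, also with denominators cleared. *)
have E4 : \forall Ph \near mdp_nbhs P, forall s t, lam s < lam t ->
    0 < p Ph t t * q Ph s s - p Ph s s * q Ph t t.
  apply: filter_forall => s; apply: filter_forall => t.
  case: (ltrP (lam s) (lam t)) => [st|_]; last exact: nearW.
  have pos : 0 < p P t t * q P s s - p P s s * q P t t.
    have -> : p P t t * q P s s - p P s s * q P t t =
      (lam t - lam s) * (q P s s * q P t t) by rewrite !pq; ring.
    by rewrite mulr_gt0 ?subr_gt0 // mulr_gt0.
  have lim' : p Ph t t * q Ph s s - p Ph s s * q Ph t t @[Ph --> mdp_nbhs P]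
      --> p P t t * q P s s - p P s s * q P t t.
    exact: cvgB (cvgM (cvp t t) (cvq s s)) (cvgM (cvp s s) (cvq t t)).
  by apply: filterS (cvgr_gt _ lim' _ pos) => Ph.
have [delta d0 H] : mdp_nbhs P (fun Ph => (forall s, 0 < q Ph s s) /\
   (forall s t, lam s < lam t -> 0 < p Ph s t * q Ph s s - p Ph s s * q Ph s t) /\
   (forall s t, lam t < lam s -> p Ph s t * q Ph s s - p Ph s s * q Ph s t < 0) /\
   (forall s t, lam s < lam t -> 0 < p Ph t t * q Ph s s - p Ph s s * q Ph t t)).
  by do !apply: filterI.
exists delta; split=> // Ph Phst sup dist s.
have {H}[qh0 [sp [sn mono]]] := H Ph Phst sup dist.
have Phuni := unichain_same_support sup Puni.
pose lh s := p Ph s s / q Ph s s.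
have lh_mono s1 t1 : lam s1 < lam t1 -> lh s1 < lh t1.
  move=> /mono; rewrite subr_gt0 /lh => H.
  by rewrite ltr_pdivrMr // mulrAC ltr_pdivlMr.
have lh_ltE s1 t1 : (lh s1 < lh t1) = (lam s1 < lam t1).
  apply/idP/idP => [|/lh_mono//]; apply: contraTT; rewrite -!leNgt le_eqVlt.
  by move=> /predU1P[/lam_inj->//|/lh_mono/ltW].
have lh_leE s1 t1 : (lh s1 <= lh t1) = (lam s1 <= lam t1) by rewrite !leNgt lh_ltE.
have lh_inj : injective lh.
  by move=> s1 t1 E; apply/lam_inj/le_anti; rewrite -!lh_leE E lexx.
have advh s1 t1 : (p Ph s1 t1 - lh s1 * q Ph s1 t1) * q Ph s1 s1 =
    p Ph s1 t1 * q Ph s1 s1 - p Ph s1 s1 * q Ph s1 t1.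
  by rewrite mulrBl /lh; congr (_ - _); rewrite mulrAC divfK ?gt_eqF.
exists (lh s); apply: (whittle_index_of_crossings Phst Phuni (s0 := s0)) => // {}s /=.
(* Since the crossings are ordered like the indices, the policy attached to [s] is the one used for
   [P]. *)
have -> : [set t | lh s <= lh t]%SET = A s by apply/setP => t; rewrite !inE lh_leE.
rewrite -!/(p Ph s _) -!/(q Ph s _); split.
  by rewrite /lh divfK ?gt_eqF ?subrr.
move=> t; rewrite -/(p Ph s t) -/(q Ph s t) !lh_ltE; split=> st.
  by rewrite -(pmulr_lgt0 _ (qh0 s)) advh sp.
by rewrite -(pmulr_llt0 _ (qh0 s)) advh sn.
Qed.
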